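(* Consider triples $(U,\mathcal{O},X)$, where $U$ is a finite set, $\mathcal{O}\subseteq\mathcal{P}(U)$ is a set of obligations (not assumed independent), and $X\subseteq U$ is nonempty and $\preceq_s$-closed. Then: (1) $X$ does not necessarily contain all best elements, i.e. there is such a triple for which some best element of $U$ is not in $X$. Assume in addition that $X$ contains all best elements of $U$. Then: (2) $X\prec_{l,s}U\setminus X$ does not necessarily hold (there is such a triple for which it fails). (3) $X$ is (ui). (4) $X\in\mathcal{D}(\mathcal{O})$ does not necessarily hold (there is such a triple for which it fails). (5) $X$ is not necessarily a neighbourhood of the set of best elements in $U$ (there is such a triple for which it is not). (6) $X$ is an improving neighbourhood of the set of best elements in $U$.
   Context: $U$ is a finite set (the set of situations under consideration), and $\mathcal{O}\subseteq\mathcal{P}(U)$ is a set of ''obligations''. For $x,y\in U$: - $\mathcal{O}(x):=\{O\in\mathcal{O}: x\in O\}$. - Quality (set variant; smaller means better): $x\sim_s y$ iff $\mathcal{O}(x)=\mathcal{O}(y)$; $x\preceq_s y$ iff $\mathcal{O}(y)\subseteq\mathcal{O}(x)$; $x\prec_s y$ iff $\mathcal{O}(y)\subsetneq\mathcal{O}(x)$. - Distance (set variant): $d_s(x,y):=\mathcal{O}(x)\,\triangle\,\mathcal{O}(y)$ (symmetric difference); distances are compared by inclusion, so they form a partial order. - $[x,z]_s:=\{y\in U: d_s(x,z)=d_s(x,y)\cup d_s(y,z)\}$. - A best element of $U$ is some $x\in U$ such that there is no $z\in U$ with $z\prec_s x$. - $X\subseteq U$ is $\preceq_s$-closed iff for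 all $x\in X$, $y\in U$: $y\preceq_s x$ implies $y\in X$. - An element $x'$ of a set $Y$ is closest to $x$ in $Y$ iff there is no $x''\in Y$ with $d_s(x,x'')\subsetneq d_s(x,x')$. Let $x\parallel Y$ be the set of elements of $Y$ closest to $x$. - $X\prec_{l,s}Y$ iff for all $x\in X$ and all $y\in x\parallel Y$ we have $x\prec_s y$, and for all $y\in Y$ and all $x\in y\parallel X$ we have $x\prec_s y$. - $X$ is (ui) (union of intersections) iff there is a family $(\mathcal{O}_i)_{i\in I}$ with $\mathcal{O}_i\subseteq\mathcal{O}$ and $X=\bigcup_{i\in I}\bigcap\mathcal{O}_i$, where $\bigcap\emptyset:=U$. - For $\mathcal{O}'\subseteq\mathcal{O}$, $\delta:\mathcal{O}'\to\{0,1\}$ and $m\in U$, $m\models\delta$ iff for all $O\in\mathcal{O}'$: $m\in O\Leftrightarrow\delta(O)=1$. - $X\in\mathcal{D}(\mathcal{O})$ iff for all $\mathcal{O}'\subseteq\mathcal{O}$, all $\delta:\mathcal{O}'\to\{0,1\}$ and all $m,m'\in U$ with $m,m'\models\delta$, $m\in X$, $m'\notin X$, there is $m''\in X$ with $m''\models\delta$ and $m''\prec_s m'$. - For $B\subseteq Y\subseteq U$: $Y$ is a neighbourhood of $B$ in $U$ iff for all $y\in Y$ and all $x\in B$ closest to $y$ in $B$, $[x,y]_s\subseteq Y$. $Y$ is an improving neighbourhood of $B$ in $U$ iff for all $y\in Y$ and all $x$ that are closest to $y$ in $\{x'\in B: x'\preceq_s y\}$, $[x,y]_s\subseteq Y$.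 (Both notions require $B\subseteq Y$.) *)

(* Defs.v *)
From mathcomp Require Import all_boot.

Set Implicit Arguments.
Unset Strict Implicit.
Unset Printing Implicit Defensive.

(* The set of situations is the whole finType [U], so [{set U}] is its power
   set; [Ob] is the set of obligations. *)

Section Obligations.

Variables (U : finType) (Ob : {set {set U}}).

Definition obl (x : U) : {set {set U}} := [set O in Ob | x \in O].

(* Smaller means better: the inclusions are reversed. *)
Definition preceq (x y : U) : bool := obl y \subset obl x.
Definition prec (x y : U) : bool := obl y \proper obl x.

(* Set-valued distance, compared by inclusion. *)
Definition dist (x y : U) : {set {set U}} :=
  (obl x :\: obl y) :|: (obl y :\: obl x).

Definition between (x z : U) : {set U} :=
  [set y | dist x z == dist x y :|: dist y z].

Definition best : {set U} := [set x | ~~ [exists z, prec z x]].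

Definition preceq_closed (X : {set U}) : Prop :=
  forall x y : U, x \in X -> preceq y x -> y \in X.

Definition closest (x : U) (Y : {set U}) : {set U} :=
  [set x' in Y | ~~ [exists x'' in Y, dist x x'' \proper dist x x']].

Definition prec_l (X Y : {set U}) : Prop :=
  (forall x y : U, x \in X -> y \in closest x Y -> prec x y) /\
  (forall y x : U, y \in Y -> x \in closest y X -> prec x y).

(* [X] is the union of the [\bigcap_(O in F i) O]; an empty intersection is
   the whole of [U]. *)
Definition ui (X : {set U}) : Prop :=
  exists (I : Type) (F : I -> {set {set U}}),
    (forall i, F i \subset Ob) /\
    (forall x : U, x \in X <-> exists i, x \in \bigcap_(O in F i) O).

Definition models (Ob' : {set {set U}}) (delta : {O | O \in Ob'} -> bool)
    (m : U) : Prop :=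
  forall O : {O | O \in Ob'}, m \in val O <-> delta O = true.

Definition in_D (X : {set U}) : Prop :=
  forall (Ob' : {set {set U}}) (delta : {O | O \in Ob'} -> bool) (m m' : U),
    Ob' \subset Ob ->
    models delta m -> models delta m' -> m \in X -> m' \notin X ->
    exists m'' : U, [/\ m'' \in X, models delta m'' & prec m'' m'].

Definition neighbourhood (B Y : {set U}) : Prop :=
  B \subset Y /\
  forall y x : U, y \in Y -> x \in closest y B -> between x y \subset Y.

Definition improving_neighbourhood (B Y : {set U}) : Prop :=
  B \subset Y /\
  forall y x : U, y \in Y -> x \in closest y [set x' in B | preceq x' y] ->
    between x y \subset Y.

End Obligations.

(* Main.v *)
Require Import Defs.
From mathcomp Require Import all_boot.

Set Implicit Arguments.
Unset Strict Implicit.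
Unset Printing Implicit Defensive.

(** All comparisons are decided obligation by obligation.  A preceq-closed [X]
    is the union over [x \in X] of the intersections of the obligations of [x];
    and if [x] is at least as good as [y], every element between them is at
    least as good as [y], which gives (6).  The negative claims share one model
    with situations [b, y, x, z] satisfying exactly the obligations [{1, 3}],
    [{1}], [{2}] and none, so that the best elements are [b] and [x]: although
    [x] and [y] are incomparable, [x] is a best element closest to [y], as
    the distance [{1, 2}] does not include the distance [{3}] from [y] to
    [b]. *)

Section Obligationwise.

Variables (U : finType) (Ob : {set {set U}}).

Lemma preceqE x y :
  preceq Ob x y = [forall O in Ob, (y \in O) ==> (x \in O)].
Proof.
apply/subsetP/forall_inP => [sub O OOb | sub O]; last first.
  by rewrite !inE => /andP[OOb yO]; rewrite OOb (implyP (sub O OOb)).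
by apply/implyP => yO; have := sub O; rewrite !inE OOb yO; apply.
Qed.

Lemma precE x y : prec Ob x y = preceq Ob x y && ~~ preceq Ob y x.
Proof. by []. Qed.

Lemma in_dist x y O :
  (O \in dist Ob x y) = (O \in Ob) && ((x \in O) (+) (y \in O)).
Proof. by rewrite !inE; case: (O \in Ob); case: (x \in O); case: (y \in O). Qed.

Lemma dist_subE x y x' y' :
  (dist Ob x y \subset dist Ob x' y') =
  [forall O in Ob, ((x \in O) (+) (y \in O)) ==> ((x' \in O) (+) (y' \in O))].
Proof.
apply/subsetP/forall_inP => [sub O OOb | sub O]; last first.
  by rewrite !in_dist => /andP[OOb xyO]; rewrite OOb (implyP (sub O OOb)).
by apply/implyP => xyO; have := sub O; rewrite !in_dist OOb xyO; apply.
Qed.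

(** An obligation on which [x] and [z] differ always separates [y] from exactly one of them, so only
    the obligations on which they agree constrain [y]. *)
Lemma in_between x y z :
  (y \in between Ob x z) =
  [forall O in Ob, ((x \in O) == (z \in O)) ==> ((y \in O) == (x \in O))].
Proof.
rewrite inE; apply/eqP/forall_inP => [/setP eq_d O OOb | btw].
  move: (eq_d O); rewrite in_dist in_setU !in_dist OOb /=.
  by case: (x \in O); case: (y \in O); case: (z \in O).
apply/setP => O; rewrite in_dist in_setU !in_dist; case OOb: (O \in Ob) => //=.
by move: (btw O OOb); case: (x \in O); case: (y \in O); case: (z \in O).
Qed.

Lemma preceq_refl x : preceq Ob x x.
Proof. exact: subxx. Qed.

(** For [x] in a closed set, the intersection therefore stays inside that set, even when [obl Ob x]
    is empty and the intersection is all of [U]. *)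
Lemma mem_bigcap_obl x y : (y \in \bigcap_(O in obl Ob x) O) = preceq Ob y x.
Proof.
rewrite preceqE; apply/bigcapP/forall_inP => [cap O OOb | sub O].
  by apply/implyP => xO; apply: cap; rewrite inE OOb.
by rewrite inE => /andP[OOb]; apply/implyP/sub.
Qed.

Lemma preceq_closed_ui (X : {set U}) : preceq_closed Ob X -> ui Ob X.
Proof.
move=> clX; exists {x | x \in X}, (fun x => obl Ob (val x)); split.
  by move=> x; apply/subsetP => O; rewrite inE => /andP[].
move=> x; split=> [xX | [[y yX]]].
  by exists (exist _ x xX); rewrite mem_bigcap_obl preceq_refl.
by rewrite mem_bigcap_obl; apply: clX.
Qed.

(** On an obligation fulfilled by [z], [x] and [z] agree, and hence [y] agrees with them. *)
Lemma between_preceq x y z :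
  preceq Ob x z -> y \in between Ob x z -> preceq Ob y z.
Proof.
rewrite !preceqE in_between => /forall_inP xz /forall_inP btw.
apply/forall_inP => O OOb; move: (xz O OOb) (btw O OOb).
by case: (x \in O); case: (y \in O); case: (z \in O).
Qed.

Lemma preceq_closed_improving (B X : {set U}) :
  preceq_closed Ob X -> B \subset X -> improving_neighbourhood Ob B X.
Proof.
move=> clX BX; split=> // y x yX; rewrite inE => /andP[].
rewrite inE => /andP[_ xy] _; apply/subsetP => w /(between_preceq xy).
exact: clX.
Qed.

End Obligationwise.

(* In the notation of the header, [b = (true, true)], [y = (true, false)],
   [x = (false, true)] and [z = (false, false)]. *)
Definition obligations4 : {set {set bool * bool}} :=
  [set [set u | u.1]; [set u | ~~ u.1 && u.2]; [set u | u.1 && u.2]].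

Lemma forall_obligations4 (P : pred {set bool * bool}) :
  [forall O in obligations4, P O] =
  [&& P [set u | u.1], P [set u | ~~ u.1 && u.2] & P [set u | u.1 && u.2]].
Proof.
apply/forall_inP/and3P => [all_P | [P1 P2 P3] O].
  by split; apply: all_P; rewrite !inE eqxx ?orbT.
by rewrite !inE => /orP[/orP[]|] /eqP ->.
Qed.

(** The set is the obligation 1 itself; it omits the best element [x], which gives (1). *)
Lemma preceq_closed_fst : preceq_closed obligations4 [set u | u.1].
Proof.
by move=> [[] []] [[] []]; rewrite preceqE forall_obligations4 !inE.
Qed.

(** The union of the obligations 2 and 3, used for (2) and (4). *)
Lemma preceq_closed_snd : preceq_closed obligations4 [set u | u.2].
Proof.
by move=> [[] []] [[] []]; rewrite preceqE forall_obligations4 !inE.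
Qed.

(** The union of the obligations 1 and 2, everything except [z], used for (5). *)
Lemma preceq_closed_or : preceq_closed obligations4 [set u | u.1 || u.2].
Proof.
by move=> [[] []] [[] []]; rewrite preceqE forall_obligations4 !inE.
Qed.

Lemma best_obligations4 : best obligations4 = [set u | u.2].
Proof.
apply/setP => -[u1 u2]; rewrite !inE /=; case: u2; last first.
  (* [b] is strictly better than both [y] and [z]. *)
  apply/negbTE; rewrite negbK; apply/existsP; exists (true, true).
  by rewrite precE !preceqE !forall_obligations4 !inE; case: u1.
apply/existsP => -[[[] []]];
  by rewrite precE !preceqE !forall_obligations4 !inE; case: u1.
Qed.

Lemma closest_obligations4 :
  (false, true) \in closest obligations4 (true, false) [set u | u.2].
Proof.
rewrite !inE /=; apply/existsP => -[[[] []]]; rewrite !inE //=.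
  by rewrite properE !dist_subE !forall_obligations4 !inE.
by rewrite properE subxx andbF.
Qed.

(** The second clause of [prec_l] fails at [y]: the closest element [x] violates the obligation 1,
    which [y] fulfils. *)
Lemma not_prec_l_obligations4 :
  ~ prec_l obligations4 [set u | u.2] (~: [set u | u.2]).
Proof.
move=> [_ /(_ (true, false) (false, true))].
rewrite !inE /= => /(_ isT).
move: closest_obligations4; rewrite !inE /= => -> /(_ isT).
by rewrite precE !preceqE !forall_obligations4 !inE.
Qed.

(* The obligation 3 is violated by [x] and [y] but fulfilled by [b], the only
   element better than [y]. *)
Lemma not_in_D_obligations4 : ~ in_D obligations4 [set u | u.2].
Proof.
pose Ob3 : {set {set bool * bool}} := [set [set u | u.1 && u.2]].
have models3 u : ~~ (u.1 && u.2) -> models (Ob' := Ob3) (fun=> false) u.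
  by move=> nu [O OOb3] /=; rewrite (set1P OOb3) inE (negbTE nu).
have sub3 : Ob3 \subset obligations4.
  by rewrite sub1set !inE eqxx orbT.
move=> /(_ Ob3 (fun=> false) (false, true) (true, false) sub3).
rewrite !inE => /(_ (models3 (false, true) isT) (models3 (true, false) isT) isT isT).
move=> [[[] []]]; rewrite !inE /= => -[] // _.
  move=> /(_ (exist _ [set u | u.1 && u.2] (set11 _))) /=.
  by rewrite inE => -[/(_ isT)].
by rewrite precE !preceqE !forall_obligations4 !inE.
Qed.

(** [x] and [y] agree only in violating the obligation 3, and so does [z]; hence [z] lies between
    them, outside the set. *)
Lemma not_neighbourhood_obligations4 :
  ~ neighbourhood obligations4 [set u | u.2] [set u | u.1 || u.2].
Proof.
move=> [_ /(_ (true, false) (false, true))].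
rewrite inE => /(_ isT closest_obligations4) /subsetP /(_ (false, false)).
rewrite in_between forall_obligations4 !inE.
by move=> /(_ isT).
Qed.

Theorem fact4p1 :
  (exists (U : finType) (Ob : {set {set U}}) (X : {set U}),
     [/\ X != set0, preceq_closed Ob X & exists x, x \in best Ob /\ x \notin X]) /\
  (exists (U : finType) (Ob : {set {set U}}) (X : {set U}),
     [/\ X != set0, preceq_closed Ob X, best Ob \subset X
       & ~ prec_l Ob X (~: X)]) /\
  (forall (U : finType) (Ob : {set {set U}}) (X : {set U}),
     X != set0 -> preceq_closed Ob X -> best Ob \subset X -> ui Ob X) /\
  (exists (U : finType) (Ob : {set {set U}}) (X : {set U}),
     [/\ X != set0, preceq_closed Ob X, best Ob \subset X & ~ in_D Ob X]) /\
  (exists (U : finType) (Ob : {set {set U}}) (X : {set U}),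
     [/\ X != set0, preceq_closed Ob X, best Ob \subset X
       & ~ neighbourhood Ob (best Ob) X]) /\
  (forall (U : finType) (Ob : {set {set U}}) (X : {set U}),
     X != set0 -> preceq_closed Ob X -> best Ob \subset X ->
     improving_neighbourhood Ob (best Ob) X).
Proof.
have nz (X : {set bool * bool}) u : u \in X -> X != set0.
  by move=> uX; apply/set0Pn; exists u.
split.
  exists _, obligations4, [set u | u.1]; split; last first.
  - by exists (false, true); rewrite best_obligations4 !inE.
  - exact: preceq_closed_fst.
  - by apply: (nz _ (true, true)); rewrite inE.
have nz2 : [set u : bool * bool | u.2] != set0.
  by apply: (nz _ (true, true)); rewrite inE.
split.
  exists _, obligations4, [set u | u.2]; rewrite best_obligations4.
  split=> //; [exact: preceq_closed_snd | exact: not_prec_l_obligations4].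
split; first by move=> U Ob X _ clX _; apply: preceq_closed_ui.
split.
  exists _, obligations4, [set u | u.2]; rewrite best_obligations4.
  split=> //; [exact: preceq_closed_snd | exact: not_in_D_obligations4].
split; last by move=> U Ob X _; apply: preceq_closed_improving.
exists _, obligations4, [set u | u.1 || u.2]; rewrite best_obligations4; split.
- by apply: (nz _ (true, true)); rewrite inE.
- exact: preceq_closed_or.
- by apply/subsetP => u; rewrite !inE orbC => ->.
- exact: not_neighbourhood_obligations4.
Qed.
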